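(* Fix a labeling of the infinite rooted binary tree $T_\infty$ with root $x_0$, an integer $\ell\geq2$ and an integer $n\geq0$. Define $\psi_n:M_{\ell,n}\to\{\pm1\}^n$ by $\psi_n(\sigma)=(e_1,\dots,e_n)$, where $e_i=\operatorname{sgn}_i(\sigma,x_0)$ if $1\le i\le\ell-1$; $e_i=+1$ if $i\geq\ell$ and $\sigma$ is an $(\ell,i)$-even cousins map above $x_0$; and $e_i=-1$ if $i\ge\ell$ and $\sigma$ is an $(\ell,i)$-odd cousins map above $x_0$. Then $\psi_n$ is a surjective group homomorphism and $\ker\psi_n$ is the commutator subgroup of $M_{\ell,n}$. In particular, the abelianization of $M_{\ell,n}$ is isomorphic to $\{\pm1\}^n$.
   Context: $T_n$ is the subtree of levels $0,\dots,n$. A labeling assigns to each node at level $m$ a word in $\{0,1\}^m$, bijectively per level, with children of $w$ labeled $w0,w1$. For a tree automorphism $\sigma$, node $y$, $m\geq1$: $\sigma$ sends the node $ys_1\dots s_m$ to $\sigma(y)t_1\dots t_m$, and $\operatorname{sgn}_m(\sigma,y)$ is the sign of the permutation $(s_i)\mapsto(t_i)$ of $\{0,1\}^m$. $M_\ell$ is the set of $\sigma\in\operatorname{Aut}(T_\infty)$ with $\operatorname{sgn}_\ell(\sigma,y)=+1$ for every node $y$, and $M_{\ell,n}$ is the group of restrictions of elements of $M_\ell$ to $T_n$. For $\sigma\in M_{\ell,n}$ and a node $w$ with children $y_0,y_1$, $\sigma$ acts $\ell$-negatively above $w$ if $\operatorname{sgn}_{\ell-1}(\sigma,y_0)=\operatorname{sgn}_{\ell-1}(\sigma,y_1)=-1$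 (these two signs are always equal for such $\sigma$). For $\ell\le i\le n$ and a node $x$, $\sigma$ is an $(\ell,i)$-odd cousins map above $x$ if the number of nodes $w$ lying $i-\ell$ levels above $x$ above which $\sigma$ acts $\ell$-negatively is odd, and an $(\ell,i)$-even cousins map otherwise. *)

(* Defs.v *)
From HB Require Import structures.
From mathcomp Require Import all_boot all_fingroup all_algebra.
From mathcomp Require Import boolp.

Set Implicit Arguments.
Unset Strict Implicit.
Unset Printing Implicit Defensive.

Import GRing.Theory.

(* The group {1, -1}, as a subset of the integers under multiplication. *)

Definition pm1 : Type := seq_sub [:: 1%R; -1 : int]%R.

HB.instance Definition _ := Finite.on pm1.

Lemma pm1_sign_subproof (b : bool) :
  ((-1) ^+ b)%R \in [:: 1%R; -1 : int]%R.
Proof. by case: b. Qed.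

Definition pm1_sign (b : bool) : pm1 := SeqSub (pm1_sign_subproof b).

Lemma pm1_mul_subproof (x y : pm1) :
  (val x * val y)%R \in [:: 1%R; -1 : int]%R.
Proof. by case: x y => [x +] [y +] /=; rewrite !inE => /orP[] /eqP-> /orP[] /eqP->. Qed.

Definition pm1_mul (x y : pm1) : pm1 := SeqSub (pm1_mul_subproof x y).

Lemma pm1_mulA : associative pm1_mul.
Proof. by move=> x y z; apply: val_inj; rewrite /= mulrA. Qed.

Lemma pm1_mul1 : left_id (pm1_sign false) pm1_mul.
Proof. by move=> x; apply: val_inj; rewrite /= mul1r. Qed.

Lemma pm1_mulV : left_inverse (pm1_sign false) id pm1_mul.
Proof.
move=> x; apply: val_inj => /=.
by case: x => /= x; rewrite !inE => /orP[] /eqP->.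
Qed.

HB.instance Definition _ := Finite_isGroup.Build pm1 pm1_mulA pm1_mul1 pm1_mulV.

Lemma pm1_sign0 : pm1_sign false = 1%g.
Proof. by []. Qed.

Lemma pm1_signM b c : pm1_sign (b (+) c) = (pm1_sign b * pm1_sign c)%g.
Proof. by apply: val_inj; case: b c => [] []. Qed.

(* The infinite rooted binary tree: the root is the empty sequence, the
   children of x are rcons x false and rcons x true, the level of x is its
   size, and the nodes above x are the x ++ v. This model only carries the tree
   structure: words enter through an arbitrary labeling (below). The tree of
   levels 0, ..., n is the finite type n.-bseq bool. *)
Definition node : Type := seq bool.

Definition root : node := [::].

Definition is_child (x y : node) : bool :=
  (y == rcons x false) || (y == rcons x true).

Definition is_tree_aut (f : node -> node) : Prop :=
  [/\ bijective f, f root = root &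
      forall x y, is_child (f x) (f y) = is_child x y].

Record labeling := Labeling {
  label : node -> seq bool;
  node_of : seq bool -> node;
  labelK : cancel label node_of;
  node_ofK : cancel node_of label;
  size_label : forall x, size (label x) = size x;
  label_children : forall x,
    perm_eq [:: label (rcons x false); label (rcons x true)]
            [:: rcons (label x) false; rcons (label x) true] }.

Section Sign.

Variable L : labeling.
Implicit Types (f g : node -> node) (x y w : node).

(* The word t_1 ... t_m such that f sends the node labeled y s_1 ... s_m to the
   node labeled f(y) t_1 ... t_m; see label_actP. *)
Definition label_act f y m (s : m.-tuple bool) : m.-tuple bool :=
  insubd s (drop (size y) (label L (f (node_of L (label L y ++ s))))).

(* The default value of insubd is never used for a tree automorphism, nor for
   the restriction of one to the levels 0, ..., n when size y + m <= n;
   see label_permE. *)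
Definition label_perm f y m : {perm m.-tuple bool} :=
  insubd (1%g : {perm m.-tuple bool}) [ffun s => label_act f y s].

Definition sgn m f y : pm1 := pm1_sign (odd_perm (label_perm f y m)).

Definition in_M l f : Prop :=
  is_tree_aut f /\ forall y, sgn l f y = pm1_sign false.

Definition acts_negatively l f w : bool :=
  (sgn l.-1 f (rcons w false) == pm1_sign true) &&
  (sgn l.-1 f (rcons w true) == pm1_sign true).

Definition odd_cousins l i f x : bool :=
  odd #|[set v : (i - l).-tuple bool | acts_negatively l f (x ++ v)]|.

Definition restricts n f (s : {perm n.-bseq bool}) : Prop :=
  forall x : n.-bseq bool, s x = f x :> node.

Definition M_set l n : {set {perm n.-bseq bool}} :=
  [set s | `[< exists f, in_M l f /\ restricts f s >]].

(* A permutation of the nodes of level at most n, as a function on all nodes;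
   the values at levels above n are irrelevant. *)
Definition extend n (s : {perm n.-bseq bool}) : node -> node :=
  fun x => if insub x is Some x' then s x' : seq bool else x.

(* The coordinates e_1, ..., e_n are indexed from 0: e_(i+1) is at i : 'I_n. *)
Definition psi l n (s : {perm n.-bseq bool}) : {dffun forall i : 'I_n, pm1} :=
  [ffun i : 'I_n =>
     if i.+1 < l then sgn i.+1 (extend s) root
     else pm1_sign (odd_cousins l i.+1 (extend s) root)].

Definition steps (g : seq bool -> seq bool) :=
  forall x b, exists c, g (rcons x b) = rcons (g x) c.

Lemma steps_cat g : steps g ->
  forall x v, exists2 v', size v' = size v & g (x ++ v) = g x ++ v'.
Proof.
move=> gP x; elim/last_ind => [|v b [v' sv' IH]]; first by exists [::]; rewrite ?cats0.
have [c E] := gP (x ++ v) b.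
by exists (rcons v' c); rewrite ?size_rcons ?sv' // -!rcons_cat E IH rcons_cat.
Qed.

Lemma steps_comp g h : steps g -> steps h -> steps (g \o h).
Proof.
by move=> gP hP x b /=; have [c ->] := hP x b; have [d ->] := gP (h x) c; exists d.
Qed.

Lemma steps_label : steps (label L).
Proof.
move=> x b; have := perm_mem (label_children L x) (label L (rcons x b)).
have -> : label L (rcons x b) \in
    [:: label L (rcons x false); label L (rcons x true)].
  by case: b; rewrite !inE eqxx ?orbT.
by rewrite !inE => /esym/orP[] /eqP->; [exists false | exists true].
Qed.

Lemma steps_node_of : steps (node_of L).
Proof.
move=> w c; have := perm_mem (label_children L (node_of L w)) (rcons w c).
rewrite node_ofK.
have -> : rcons w c \in [:: rcons w false; rcons w true].
  by case: c; rewrite !inE eqxx ?orbT.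
rewrite !inE => /orP[] /eqP->; rewrite labelK; [by exists false | by exists true].
Qed.

Lemma steps_aut f : is_tree_aut f -> steps f.
Proof.
move=> [_ _ fP] x b; have := fP x (rcons x b).
have -> : is_child x (rcons x b) by case: b; rewrite /is_child eqxx ?orbT.
by case/orP => /eqP->; [exists false | exists true].
Qed.

Lemma size_aut f : is_tree_aut f -> forall x, size (f x) = size x.
Proof.
move=> fA x; have [v' sv'] := steps_cat (steps_aut fA) root x.
by case: fA => _ -> _ /= ->.
Qed.

Lemma label_actP f y m (s : m.-tuple bool) : is_tree_aut f ->
  label L (f (node_of L (label L y ++ s))) = label L (f y) ++ label_act f y s.
Proof.
move=> fA.
have gP := steps_comp (steps_comp steps_label (steps_aut fA)) steps_node_of.
have [t st] := steps_cat gP (label L y) s.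
rewrite /label_act /= labelK => ->.
rewrite drop_size_cat ?size_label ?size_aut // insubdK //.
by rewrite unfold_in /= st size_tuple eqxx.
Qed.

Lemma label_act_inj f y m : is_tree_aut f -> injective (@label_act f y m).
Proof.
move=> fA s t E; apply: val_inj.
have : label L (f (node_of L (label L y ++ s))) =
       label L (f (node_of L (label L y ++ t))) by rewrite !label_actP // E.
move/(can_inj (labelK L)); case: fA => /bij_inj fI _ _ /fI.
by move/(can_inj (node_ofK L))/eqP; rewrite eqseq_cat // eqxx => /eqP.
Qed.

Lemma label_permE f y m (s : m.-tuple bool) : is_tree_aut f ->
  label_perm f y m s = label_act f y s.
Proof.
move=> fA; rewrite -pvalE insubdK ?ffunE //.
apply/injectiveP => a b; rewrite !ffunE; exact: label_act_inj.
Qed.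

Lemma is_tree_aut_id : is_tree_aut id.
Proof. by split => //; exists id. Qed.

Lemma is_tree_aut_comp f g :
  is_tree_aut f -> is_tree_aut g -> is_tree_aut (f \o g).
Proof.
move=> [fb f0 fP] [gb g0 gP]; split; first exact: bij_comp.
  by rewrite /= g0.
by move=> x y /=; rewrite fP gP.
Qed.

Lemma sgn_id m y : sgn m id y = 1%g.
Proof.
rewrite /sgn; have -> : label_perm id y m = 1%g; last by rewrite odd_perm1.
apply/permP => s; rewrite perm1 (label_permE _ _ is_tree_aut_id).
have := label_actP y s is_tree_aut_id; rewrite node_ofK => /eqP.
by rewrite eqseq_cat // eqxx => /eqP/val_inj.
Qed.

Lemma sgn_comp m f g y : is_tree_aut f -> is_tree_aut g ->
  sgn m (f \o g) y = (sgn m f (g y) * sgn m g y)%g.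
Proof.
move=> fA gA; have fgA := is_tree_aut_comp fA gA.
rewrite /sgn -pm1_signM addbC -odd_permM; congr (pm1_sign (odd_perm _)).
apply/permP => s; rewrite permM !label_permE //; apply: val_inj.
have := label_actP y s fgA; rewrite /=.
have := label_actP y s gA => /(congr1 (node_of L)); rewrite labelK => ->.
by rewrite label_actP // => /eqP; rewrite eqseq_cat // eqxx => /eqP.
Qed.

Lemma M_group_set l n : group_set (M_set l n).
Proof.
apply/group_setP; split.
  rewrite inE; apply/asboolP; exists id; split; last by move=> x; rewrite perm1.
  by split=> [|y]; [exact: is_tree_aut_id | rewrite sgn_id].
move=> s t; rewrite !inE => /asboolP[f [[fA fM] fs]] /asboolP[g [[gA gM] gt]].
apply/asboolP; exists (g \o f); split; last by move=> x; rewrite permM gt fs.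
split; first exact: is_tree_aut_comp.
by move=> y; rewrite sgn_comp // fM gM pm1_sign0 mulg1.
Qed.

Canonical M l n : {group {perm n.-bseq bool}} := Group (M_group_set l n).

(* On M_set l n the signs computed from the extension agree with those of any
   automorphism of the infinite tree that it restricts. *)
Lemma sgn_extend n m f (s : {perm n.-bseq bool}) y : is_tree_aut f ->
  restricts f s -> size y + m <= n -> sgn m (extend s) y = sgn m f y.
Proof.
move=> fA fs ymn; rewrite /sgn /label_perm.
congr (pm1_sign (odd_perm (insubd _ _))); apply/ffunP => t.
rewrite !ffunE /label_act; congr (insubd _ (drop _ (label L _))).
rewrite /extend; case: insubP => [x' _ xE | ]; first by rewrite fs xE.
by rewrite -(size_label L) node_ofK size_cat size_label size_tuple ymn.
Qed.

End Sign.

(* Main.v *)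
(* Record a tree automorphism by its portrait, the set of nodes (read as words
   through the labeling) whose two children it exchanges. Only the exchanges at
   relative depth m - 1 above y matter for sgn_m(-, y), so M_l consists of the
   portraits having, for every w, an even number of exchanges at relative depth
   l - 1 above w, and the coordinate e_(i+1) of psi is a parity of exchanges on
   level i. Both conditions involve one level at a time, and on one level the
   composition of automorphisms is the addition of portraits mod 2. Hence psi is
   surjective, and a portrait is a product of its levels, so that the kernel can
   be treated level by level.

   The commutator of an element of M_l with portrait p on level j and of one
   moving words of length j by g has portrait p + p o g on level j. Two kinds of
   g suffice to move, modulo such differences, every level to a multiple of a
   fixed standard one: bitwise translations by a word, and translations
   performed only where a given bit has a given value. Both lie in M_l, since
   they do not distinguish the values of the first of the l - 1 bits over which
   the parity is taken. *)

Require Import Defs.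
From mathcomp Require Import all_boot all_fingroup.
From mathcomp Require Import commutator boolp.

Set Implicit Arguments.
Unset Strict Implicit.
Unset Printing Implicit Defensive.

Lemma pm1_sign_inj : injective pm1_sign.
Proof. by case=> [] [] // /(congr1 val). Qed.

Lemma pm1_signP (x : pm1) : exists b, x = pm1_sign b.
Proof.
case: x => x xP; have := xP; rewrite !inE => /orP[] /eqP xE.
  by exists false; apply: val_inj.
by exists true; apply: val_inj.
Qed.

Lemma mulgC_pm1 : commutative (fun x y : pm1 => x * y)%g.
Proof.
move=> x y; have [[a ->] [b ->]] := (pm1_signP x, pm1_signP y).
by rewrite -!pm1_signM addbC.
Qed.

Lemma is_childP (x y : node) : reflect (exists b, y = rcons x b) (is_child x y).
Proof.
apply: (iffP orP) => [[] /eqP-> | [[] ->]]; first by exists false.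
- by exists true.
- by right.
- by left.
Qed.

Lemma eqseq_cat_cons (T : eqType) (y w s t : seq T) b c : size s = size t ->
  (w ++ b :: t == y ++ c :: s) = [&& w == y, b == c & t == s].
Proof.
move=> st; have [wy|wy] := eqVneq (size w) (size y).
  by rewrite eqseq_cat // eqseq_cons.
transitivity false; last by case: (eqVneq w y) wy => // ->; rewrite eqxx.
apply: contraNF wy => /eqP/(congr1 size)/eqP.
by rewrite !size_cat /= st eqn_add2r.
Qed.

(** * Signs of permutations *)

Lemma odd_card (T : finType) (A : {set T}) :
  odd #|A| = \big[addb/false]_(x : T) (x \in A).
Proof.
rewrite -sum1_card (big_morph odd oddD (erefl _)) big_mkcond /=.
by apply: eq_bigr => x _; case: ifP.
Qed.

Lemma odd_perm_bij (T X : finType) (e : T -> X) (s : {perm T}) (t : {perm X}) :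
  bijective e -> (forall x, t (e x) = e (s x)) -> odd_perm t = odd_perm s.
Proof.
move=> eB tE; have e_inj := bij_inj eB.
have t_expE i x : (t ^+ i)%g (e x) = e ((s ^+ i)%g x).
  by rewrite !permX; elim: i => //= i ->.
have porbitE x : porbit t (e x) = e @: porbit s x.
  apply/setP => y; apply/porbitP/imsetP => [[i ->] | [_ /porbitP[i ->] ->]].
    by exists ((s ^+ i)%g x); rewrite ?mem_porbit.
  by exists i.
rewrite /odd_perm (bij_eq_card eB) -(card_imset _ (imset_inj e_inj)).
congr (_ (+) odd #|pred_of_set _|); rewrite /porbits -imset_comp.
have [e' _ e'K] := eB; apply/setP => B; apply/imsetP/imsetP => -[x _ ->].
  by exists (e' x); rewrite //= -porbitE e'K.
by exists (e x); rewrite //= porbitE.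
Qed.

Section WreathPerm.

Variable T : finType.
Implicit Types (s t : {perm T}) (p q : pred T).

Definition wreath_fun s p (xa : T * bool) : T * bool :=
  (s xa.1, xa.2 (+) p xa.1).

Lemma wreath_fun_inj s p : injective (wreath_fun s p).
Proof. by move=> [x a] [y b] [/perm_inj<- /addIb->]. Qed.

Definition wreath_perm s p : {perm T * bool} := perm (@wreath_fun_inj s p).

Lemma wreath_permE s p x a : wreath_perm s p (x, a) = (s x, a (+) p x).
Proof. by rewrite permE. Qed.

Lemma eq_wreath_perm s p q : p =1 q -> wreath_perm s p = wreath_perm s q.
Proof. by move=> pq; apply/permP => -[x a]; rewrite !wreath_permE pq. Qed.

Lemma wreath_perm1 : wreath_perm 1 xpred0 = 1%g.
Proof. by apply/permP => -[x a]; rewrite wreath_permE !perm1 addbF. Qed.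

Lemma wreath_permM s t p q :
  wreath_perm (s * t) (fun x => p x (+) q (s x)) =
  (wreath_perm s p * wreath_perm t q)%g.
Proof. by apply/permP => -[x a]; rewrite permM !wreath_permE permM addbA. Qed.

Lemma wreath_perm_tperm x y :
  wreath_perm (tperm x y) xpred0 =
  (tperm (x, false) (y, false) * tperm (x, true) (y, true))%g.
Proof.
have slice c z a : tperm (x, c) (y, c) (z, a) =
    (if a == c then tperm x y z else z, a).
  case: eqP => [->|/eqP ac].
    by rewrite (inj_tperm _ _ _ (f := pair^~ c)) // => u v [].
  by rewrite tpermD // xpair_eqE negb_and [c == a]eq_sym ac orbT.
by apply/permP => -[z []]; rewrite permM wreath_permE addbF !slice.
Qed.

Lemma wreath_perm_pred1 x :
  wreath_perm 1 (pred1 x) = tperm (x, false) (x, true).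
Proof.
apply/permP => -[z a]; rewrite wreath_permE perm1 /=.
have [->|zx] := eqVneq z x; first by case: a; rewrite ?tpermL ?tpermR.
by rewrite tpermD ?addbF // xpair_eqE negb_and eq_sym zx.
Qed.

Lemma odd_wreath_perm_pred0 s : odd_perm (wreath_perm s xpred0) = false.
Proof.
have [ts -> _] := prod_tpermP s; elim: ts => [|[x y] ts IHts].
  by rewrite big_nil wreath_perm1 odd_perm1.
rewrite big_cons (wreath_permM _ _ xpred0 xpred0) odd_permM {}IHts addbF.
by rewrite wreath_perm_tperm odd_permM !odd_tperm !xpair_eqE !andbT addbb.
Qed.

Lemma odd_wreath_perm_id p :
  odd_perm (wreath_perm 1 p) = \big[addb/false]_x p x.
Proof.
pose part (r : seq T) y := \big[addb/false]_(x <- r) (p x && (y == x)).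
transitivity (odd_perm (wreath_perm 1 (part (index_enum T)))).
  congr (odd_perm _); apply: eq_wreath_perm => y; rewrite /part (bigD1 y) //=.
  rewrite eqxx andbT big1 ?addbF // => x.
  by rewrite eq_sym => /negPf->; rewrite andbF.
elim: (index_enum T) => [|x r IHr].
  rewrite big_nil -(odd_perm1 (T * bool)%type) -wreath_perm1.
  by congr (odd_perm _); apply: eq_wreath_perm => y; rewrite /part big_nil.
rewrite big_cons -{}IHr.
transitivity (odd_perm (wreath_perm 1 (fun y => p x && (y == x)) *
                        wreath_perm 1 (part r))).
  rewrite -wreath_permM mulg1; congr (odd_perm _).
  by apply: eq_wreath_perm => y; rewrite perm1 /part big_cons.
rewrite odd_permM; congr addb; case: (p x) => /=; last first.
  by rewrite wreath_perm1 odd_perm1.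
by rewrite wreath_perm_pred1 odd_tperm xpair_eqE eqxx.
Qed.

Lemma odd_wreath_perm s p :
  odd_perm (wreath_perm s p) = \big[addb/false]_x p x.
Proof.
rewrite -odd_wreath_perm_id -[RHS]addbF -(odd_wreath_perm_pred0 s) -odd_permM.
rewrite -wreath_permM mul1g; congr (odd_perm _).
by apply: eq_wreath_perm => x; rewrite addbF.
Qed.

End WreathPerm.

(** * Parities over words *)

Definition parity m (f : pred (seq bool)) : bool :=
  \big[addb/false]_(v : m.-tuple bool) f v.

Lemma eq_parity m (f g : pred (seq bool)) :
  (forall v, size v = m -> f v = g v) -> parity m f = parity m g.
Proof. by move=> fg; apply: eq_bigr => v _; rewrite fg ?size_tuple. Qed.

Lemma parity0 m (f : pred (seq bool)) :
  (forall v, size v = m -> f v = false) -> parity m f = false.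
Proof.
by move=> f0; rewrite /parity big1 // => v _; rewrite f0 ?size_tuple.
Qed.

Lemma parityD m (f g : pred (seq bool)) :
  parity m (fun v => f v (+) g v) = parity m f (+) parity m g.
Proof. exact: big_split. Qed.

Lemma parityZ m a (f : pred (seq bool)) :
  parity m (fun v => a && f v) = a && parity m f.
Proof. by rewrite /parity big_distrr. Qed.

Lemma parity_reindex m (h : seq bool -> seq bool) (f : pred (seq bool)) :
    (forall v, size (h v) = size v) -> injective h ->
  parity m (fun v => f (h v)) = parity m f.
Proof.
move=> size_h h_inj.
pose k (v : m.-tuple bool) : m.-tuple bool := insubd v (h v).
have kE v : k v = h v :> seq bool.
  by rewrite /k val_insubd /= size_h size_tuple eqxx.
have k_inj : injective k.
  by move=> u v /(congr1 val); rewrite /= !kE => /h_inj/val_inj.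
by rewrite /parity [RHS](reindex_inj k_inj); apply: eq_bigr => v _; rewrite kE.
Qed.

Lemma parity_cons m (f : pred (seq bool)) :
  parity m.+1 f =
  parity m (fun v => f (false :: v)) (+) parity m (fun v => f (true :: v)).
Proof.
pose cons_pair (bv : bool * m.-tuple bool) := [tuple of bv.1 :: bv.2].
rewrite /parity (reindex cons_pair) /=; last first.
  exists (fun v => (thead v, [tuple of behead v])) => [[b v] _|v _].
    by congr pair; apply: val_inj.
  by rewrite [RHS]tuple_eta.
rewrite -(pair_bigA _ (fun b (v : m.-tuple bool) => f (b :: v))) /=.
by rewrite big_bool addbC.
Qed.

Lemma parity_cat m k (f : pred (seq bool)) :
  parity (m + k) f = parity m (fun u => parity k (fun v => f (u ++ v))).
Proof.
elim: m f => [|m IHm] f; last by rewrite addSn !parity_cons !IHm.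
by rewrite {2}/parity (big_pred1 [tuple]) // => v; apply/esym/eqP/tuple0.
Qed.

Lemma parity_pred1 m (x : seq bool) (f : pred (seq bool)) :
  size x = m -> parity m (fun v => f v && (x == v)) = f x.
Proof.
move=> sx; have sxt : size x == m by rewrite sx.
rewrite /parity (bigD1 (Tuple sxt)) //= eqxx andbT big1 ?addbF // => v.
by rewrite -val_eqE eq_sym /= => /negPf->; rewrite andbF.
Qed.

(** * Portraits acting on words *)

Implicit Types (p q g : pred (seq bool)) (u v w x y : seq bool).
Implicit Types (J K : pred nat).

Fixpoint act p w : seq bool :=
  if w is b :: w' then (b (+) p [::]) :: act (fun v => p (b :: v)) w' else [::].

Fixpoint act_inv p w : seq bool :=
  if w is b :: w' then
    let c := b (+) p [::] in c :: act_inv (fun v => p (c :: v)) w'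
  else [::].

Lemma actK p : cancel (act p) (act_inv p).
Proof. by move=> w; elim: w p => //= b w IHw p; rewrite addbK IHw. Qed.

Lemma act_invK p : cancel (act_inv p) (act p).
Proof. by move=> w; elim: w p => //= b w IHw p; rewrite addbK IHw. Qed.

Lemma act_inj p : injective (act p).
Proof. exact: can_inj (actK p). Qed.

Lemma eq_act_eq p w x : (act p w == act p x) = (w == x).
Proof. exact: inj_eq (@act_inj p) w x. Qed.

Lemma size_act p w : size (act p w) = size w.
Proof. by elim: w p => //= b w IHw p; rewrite IHw. Qed.

Lemma act_cat p u v : act p (u ++ v) = act p u ++ act (fun w => p (u ++ w)) v.
Proof. by elim: u p => //= b u IHu p; rewrite IHu. Qed.

Lemma act_rcons p w b : act p (rcons w b) = rcons (act p w) (b (+) p w).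
Proof. by rewrite -cats1 act_cat /= cats0 cats1. Qed.

Lemma eq_act p q w :
  (forall v, size v < size w -> p v = q v) -> act p w = act q w.
Proof.
elim: w p q => //= b w IHw p q pq; congr (_ :: _); first by rewrite pq.
by apply: IHw => v sv; rewrite pq.
Qed.

Lemma act_pred0 w : act xpred0 w = w.
Proof. by elim: w => //= b w ->; rewrite addbF. Qed.

Lemma act_fix p w : (forall v, size v < size w -> p v = false) -> act p w = w.
Proof. by move=> p0; rewrite (eq_act (q := xpred0)) ?act_pred0. Qed.

Lemma nth_act p w i : i < size w ->
  nth false (act p w) i = nth false w i (+) p (take i w).
Proof. by elim: w p i => //= b w IHw p [|i] //= /IHw->. Qed.

Definition portrait_mul p q w : bool := p w (+) q (act p w).

Lemma act_mul p q w : act (portrait_mul p q) w = act q (act p w).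
Proof.
elim: w p q => //= b w IHw p q; rewrite -IHw.
by congr (_ :: _); rewrite /portrait_mul /= addbA.
Qed.

Definition parity_above m p w : bool := parity m (fun v => p (w ++ v)).

Lemma parity_aboveS m p w :
  parity_above m.+1 p w =
  parity_above m p (rcons w false) (+) parity_above m p (rcons w true).
Proof.
by rewrite /parity_above parity_cons; congr addb; apply: eq_parity => v _;
  rewrite cat_rcons.
Qed.

Lemma parity_above_mul m p q w :
  parity_above m (portrait_mul p q) w =
  parity_above m p w (+) parity_above m q (act p w).
Proof.
rewrite /parity_above parityD; congr addb; under eq_parity do rewrite act_cat.
exact: (parity_reindex _ (fun v => q (act p w ++ v)) (size_act _) (@act_inj _)).
Qed.

Definition on_levels J p w : bool := J (size w) && p w.

Lemma parity_above_on_levels J m p w :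
  parity_above m (on_levels J p) w = J (size w + m) && parity_above m p w.
Proof.
by rewrite -parityZ; apply: eq_parity => v vm; rewrite /on_levels size_cat vm.
Qed.

Lemma act_on_levels_lt j p w : size w <= j ->
  act (on_levels (gtn j) p) w = act p w.
Proof.
by move=> wj; apply: eq_act => v vw; rewrite /on_levels /= (leq_trans vw wj).
Qed.

Lemma portrait_mul_on_levels J K p q w :
    (forall a b, J a -> K b -> b <= a) ->
  portrait_mul (on_levels J p) (on_levels K q) w =
  on_levels J p w (+) on_levels K q w.
Proof.
move=> KJ; congr addb; rewrite /on_levels size_act.
case: (boolP (K _)) => //= wK.
rewrite act_fix // => v vw; case: (boolP (J _)) => //= vJ.
by have := KJ _ _ vJ wK; rewrite leqNgt vw.
Qed.

(** * Tree automorphisms and their portraits *)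

Section TreeAutomorphisms.

Variable L : labeling.

Lemma size_node_of w : size (node_of L w) = size w.
Proof. by rewrite -(size_label L) node_ofK. Qed.

Lemma steps_act p : steps (act p).
Proof. by move=> w b; rewrite act_rcons; eexists. Qed.

Lemma steps_act_inv p : steps (act_inv p).
Proof.
move=> w b; exists (b (+) p (act_inv p w)); apply: (@act_inj p).
by rewrite act_rcons !act_invK addbK.
Qed.

Definition portrait_aut p (x : node) : node := node_of L (act p (label L x)).

Lemma is_tree_aut_portrait p : is_tree_aut (portrait_aut p).
Proof.
pose h x := node_of L (act_inv p (label L x)).
have autK : cancel (portrait_aut p) h.
  by move=> x; rewrite /h /portrait_aut node_ofK actK labelK.
have h_autK : cancel h (portrait_aut p).
  by move=> x; rewrite /h /portrait_aut node_ofK act_invK labelK.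
have aut_steps : steps (portrait_aut p) :=
  steps_comp (steps_comp (steps_node_of L) (steps_act p)) (steps_label L).
have h_steps : steps h :=
  steps_comp (steps_comp (steps_node_of L) (steps_act_inv p)) (steps_label L).
split; first by exists h.
  by apply: size0nil; rewrite size_node_of size_act size_label.
move=> x y; apply/is_childP/is_childP => [[b] | [b ->]]; last exact: aut_steps.
move/(congr1 h); rewrite autK => ->.
by rewrite -[in rcons x](autK x); apply: h_steps.
Qed.

Definition portrait (f : node -> node) w : bool :=
  last false (label L (f (node_of L (rcons w false)))).

Lemma portrait_autE f : is_tree_aut f -> f = portrait_aut (portrait f).
Proof.
move=> fA; pose F w := label L (f (node_of L w)).
have F_steps : steps F :=
  steps_comp (steps_comp (steps_label L) (steps_aut fA)) (steps_node_of L).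
have F_inj : injective F.
  move=> v w /(can_inj (labelK L)); case: fA => /bij_inj f_inj _ _ /f_inj.
  exact: (can_inj (node_ofK L)).
suff FE w : F w = act (portrait f) w.
  by apply/funext => x; rewrite /portrait_aut -FE /F !labelK.
elim/last_ind: w => [|w b IHw].
  by apply: size0nil; rewrite size_label size_aut // size_node_of.
have [c F_false] := F_steps w false; have [d F_true] := F_steps w true.
have portraitE : portrait f w = c.
  by rewrite /portrait -/(F (rcons w false)) F_false last_rcons.
have cd : d = ~~ c.
  have /eqP : F (rcons w false) <> F (rcons w true).
    by move/F_inj/rcons_inj => [].
  by rewrite F_false F_true eqseq_rcons eqxx; case: (c) (d) => [] [].
by rewrite act_rcons -IHw portraitE; case: b; rewrite ?F_false ?F_true ?cd.
Qed.

Lemma label_act_portrait p y m (s : m.-tuple bool) :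
  label_act L (portrait_aut p) y s =
  act (fun w => p (label L y ++ w)) s :> seq bool.
Proof.
have := label_actP L y s (is_tree_aut_portrait p).
rewrite /portrait_aut !node_ofK act_cat => /eqP.
by rewrite eqseq_cat // eqxx => /eqP/esym.
Qed.

Lemma sgn_portrait p y m :
  sgn L m.+1 (portrait_aut p) y = pm1_sign (parity_above m p (label L y)).
Proof.
have fA := is_tree_aut_portrait p; congr pm1_sign.
pose e (sb : m.-tuple bool * bool) := [tuple of rcons sb.1 sb.2].
pose q (s : m.-tuple bool) := p (label L y ++ s).
have eB : bijective e.
  apply: inj_card_bij => [[s a] [t b]|].
    by move=> /(congr1 val)/rcons_inj[/val_inj-> ->].
  by rewrite card_prod !card_tuple card_bool expnSr.
transitivity (odd_perm (wreath_perm (label_perm L (portrait_aut p) y m) q));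
  last exact: odd_wreath_perm.
apply: odd_perm_bij eB _ => -[s a]; apply: val_inj.
by rewrite wreath_permE /= !label_permE // !label_act_portrait act_rcons.
Qed.

End TreeAutomorphisms.

(** * Restrictions to finite levels *)

Section PortraitPerm.

Variables (L : labeling) (n : nat).

Definition portrait_bseq p (x : n.-bseq bool) : n.-bseq bool :=
  insubd x (portrait_aut L p x).

Lemma val_portrait_bseq p (x : n.-bseq bool) :
  portrait_bseq p x = portrait_aut L p x :> seq bool.
Proof.
rewrite val_insubd /= size_aut ?size_bseq //.
exact: is_tree_aut_portrait.
Qed.

Lemma portrait_bseq_inj p : injective (portrait_bseq p).
Proof.
move=> x y /(congr1 val); rewrite /= !val_portrait_bseq.
have [/bij_inj aut_inj _ _] := is_tree_aut_portrait L p.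
by move/aut_inj/val_inj.
Qed.

Definition portrait_perm p : {perm n.-bseq bool} := perm (@portrait_bseq_inj p).

Lemma restricts_portrait p : restricts (portrait_aut L p) (portrait_perm p).
Proof. by move=> x; rewrite permE val_portrait_bseq. Qed.

Lemma sgn_portrait_perm p y m : size y + m.+1 <= n ->
  sgn L m.+1 (extend (portrait_perm p)) y =
  pm1_sign (parity_above m p (label L y)).
Proof.
move=> ymn; rewrite -sgn_portrait.
exact: sgn_extend (is_tree_aut_portrait L p) (restricts_portrait p) ymn.
Qed.

Lemma eq_portrait_perm p q :
  (forall w, size w < n -> p w = q w) -> portrait_perm p = portrait_perm q.
Proof.
move=> pq; apply/permP => x; apply: val_inj; rewrite /= !restricts_portrait.
congr node_of; apply: eq_act => v; rewrite size_label => vx; apply: pq.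
exact: leq_trans vx (size_bseq x).
Qed.

Lemma portrait_permM p q :
  portrait_perm (portrait_mul p q) = (portrait_perm p * portrait_perm q)%g.
Proof.
apply/permP => x; apply: val_inj; rewrite permM /= !restricts_portrait.
by rewrite /portrait_aut node_ofK act_mul.
Qed.

Lemma portrait_perm_pred0 : portrait_perm xpred0 = 1%g.
Proof.
apply/permP => x; apply: val_inj; rewrite /= restricts_portrait perm1.
by rewrite /portrait_aut act_pred0 labelK.
Qed.

Definition level_perm j p : {perm n.-bseq bool} :=
  portrait_perm (on_levels (pred1 j) p).

Lemma eq_level_perm j p q :
  (forall w, size w = j -> p w = q w) -> level_perm j p = level_perm j q.
Proof.
move=> pq; apply: eq_portrait_perm => w _; rewrite /on_levels /=.
by case: eqP => // /pq->.
Qed.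

Lemma level_perm_pred0 j : level_perm j xpred0 = 1%g.
Proof.
rewrite -portrait_perm_pred0; apply: eq_portrait_perm => w _.
by rewrite /on_levels andbF.
Qed.

Lemma level_permD j p q :
  level_perm j (fun w => p w (+) q w) = (level_perm j p * level_perm j q)%g.
Proof.
rewrite -portrait_permM; apply: eq_portrait_perm => w _.
rewrite portrait_mul_on_levels; first by rewrite /on_levels andb_addr.
by move=> a b /eqP-> /eqP->.
Qed.

Lemma level_permV j p : ((level_perm j p)^-1 = level_perm j p)%g.
Proof.
apply/eqP; rewrite eq_invg_mul -level_permD -(level_perm_pred0 j); apply/eqP.
by apply: eq_level_perm => w _; rewrite addbb.
Qed.

Lemma level_perm_parity j m (f : seq bool -> pred (seq bool)) :
  level_perm j (fun w => parity m (fun x => f x w)) =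
  (\prod_(x : m.-tuple bool) level_perm j (f x))%g.
Proof.
rewrite /parity; elim: (index_enum _) => [|x r IHr].
  rewrite big_nil -(level_perm_pred0 j).
  by apply: eq_level_perm => w _; rewrite big_nil.
rewrite big_cons -IHr -level_permD.
by apply: eq_level_perm => w _; rewrite big_cons.
Qed.

Lemma portrait_perm_truncateS j p :
  portrait_perm (on_levels (gtn j.+1) p) =
  (level_perm j p * portrait_perm (on_levels (gtn j) p))%g.
Proof.
rewrite -portrait_permM; apply: eq_portrait_perm => w _.
rewrite portrait_mul_on_levels => [|a b /eqP-> /ltnW//].
by rewrite /on_levels /= ltnS; case: ltngtP; rewrite ?addbF.
Qed.

Lemma level_permJ j p g :
  (level_perm j p ^ (portrait_perm (on_levels (gtn j) g))^-1 =
   level_perm j (fun w => p (act g w)))%g.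
Proof.
rewrite conjgE invgK mulgA; apply: (canLR (mulgK _)).
rewrite -!portrait_permM; apply: eq_portrait_perm => w _.
rewrite [RHS]portrait_mul_on_levels => [|a b /eqP-> /ltnW//].
rewrite /portrait_mul addbC; congr addb; rewrite /on_levels size_act /=.
by case: eqP => //= wj; rewrite act_on_levels_lt ?wj.
Qed.

End PortraitPerm.

(** * The homomorphism psi in terms of portraits *)

Section BalancedPortraits.

(* Here l = k.+2. *)
Variables (L : labeling) (k n : nat).

Definition balanced p := forall w, parity_above k.+1 p w = false.

Lemma balancedI p :
    (forall w v, size v = k -> p (w ++ false :: v) = p (w ++ true :: v)) ->
  balanced p.
Proof.
by move=> pE w; rewrite /parity_above parity_cons (eq_parity (pE w)) addbb.
Qed.

Lemma balanced_rcons p w b : balanced p ->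
  parity_above k p (rcons w b) = parity_above k p (rcons w false).
Proof.
by case: b => // /(_ w); rewrite parity_aboveS => /(canRL (addbK _))->.
Qed.

Lemma balanced_mul p q :
  balanced p -> balanced q -> balanced (portrait_mul p q).
Proof. by move=> pB qB w; rewrite parity_above_mul pB qB. Qed.

Lemma balanced_on_levels J p : balanced p -> balanced (on_levels J p).
Proof. by move=> pB w; rewrite parity_above_on_levels pB andbF. Qed.

Lemma in_M_portrait p : in_M L k.+2 (portrait_aut L p) <-> balanced p.
Proof.
split=> [[_ pM] w | pB].
  by apply: pm1_sign_inj; rewrite -(pM (node_of L w)) sgn_portrait node_ofK.
split=> [|y]; first exact: is_tree_aut_portrait.
by rewrite sgn_portrait pB.
Qed.

Lemma M_portraitP (s : {perm n.-bseq bool}) :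
  reflect (exists2 p, balanced p & s = portrait_perm L n p) (s \in M L k.+2 n).
Proof.
rewrite inE; apply: (iffP (asboolP _)) => [[f [fM fs]] | [p pB ->]].
  have [fA _] := fM; rewrite (portrait_autE L fA) in fM fs.
  exists (portrait L f); first exact/in_M_portrait.
  by apply/permP => x; apply: val_inj; rewrite /= fs restricts_portrait.
exists (portrait_aut L p).
by split; [apply/in_M_portrait | apply: restricts_portrait].
Qed.

(* For [k < i] the two halves above a word have the same parity when [p] is
   balanced, so the half above [rcons v false] alone tells whether the
   automorphism acts negatively above [v]. *)
Definition psi_exponent p i : bool :=
  if i <= k then parity i p
  else parity (i - k.+1) (fun v => parity_above k p (rcons v false)).

Lemma eq_psi_exponent p q i : (forall w, size w = i -> p w = q w) ->
  psi_exponent p i = psi_exponent q i.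
Proof.
move=> pq; rewrite /psi_exponent; case: leqP => ki; first exact: eq_parity.
apply: eq_parity => v vi; apply: eq_parity => t tk; apply: pq.
by rewrite size_cat size_rcons vi tk addSnnS subnK.
Qed.

Lemma psi_exponent_on_levels J p i :
  psi_exponent (on_levels J p) i = J i && psi_exponent p i.
Proof.
rewrite (@eq_psi_exponent _ (fun w => J i && p w)) => [|w <-//].
rewrite /psi_exponent; case: leqP => _; first exact: parityZ.
by rewrite -parityZ; apply: eq_parity => v _; apply: parityZ.
Qed.

Lemma psi_exponentM p q i : balanced q ->
  psi_exponent (portrait_mul p q) i = psi_exponent p i (+) psi_exponent q i.
Proof.
move=> qB; rewrite /psi_exponent; case: leqP => _.
  exact: (parity_above_mul i p q [::]).
under eq_parity do rewrite parity_above_mul act_rcons balanced_rcons //.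
rewrite parityD; congr addb.
exact: (parity_reindex _ (fun v => parity_above k q (rcons v false))
  (size_act _) (@act_inj _)).
Qed.

Lemma acts_negatively_portrait p w : balanced p -> size w + k.+2 <= n ->
  acts_negatively L k.+2 (extend (portrait_perm L n p)) w =
  parity_above k p (rcons (label L w) false).
Proof.
move=> pB wn.
have sgn_child b : sgn L k.+1 (extend (portrait_perm L n p)) (rcons w b) =
    pm1_sign (parity_above k p (rcons (label L w) false)).
  rewrite sgn_portrait_perm ?size_rcons ?addSnnS //.
  by have [c ->] := steps_label L w b; rewrite balanced_rcons.
by rewrite /acts_negatively !sgn_child andbb (inj_eq pm1_sign_inj) eqb_id.
Qed.

Lemma psi_portrait p (i : 'I_n) : balanced p ->
  psi L k.+2 (portrait_perm L n p) i = pm1_sign (psi_exponent p i).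
Proof.
move=> pB; rewrite ffunE !ltnS /psi_exponent; case: leqP => ki.
  rewrite sgn_portrait_perm ?(ltn_ord i) //.
  by rewrite (size0nil (size_label L Defs.root)).
congr pm1_sign; rewrite /odd_cousins odd_card subSS.
rewrite -(parity_reindex _ _ (size_label L) (can_inj (labelK L))).
apply: eq_bigr => v _; rewrite inE acts_negatively_portrait //.
by rewrite size_tuple addnS subnK.
Qed.

Lemma psiM : {in M L k.+2 n &, {morph @psi L k.+2 n : s t / (s * t)%g}}.
Proof.
move=> _ _ /M_portraitP[p pB ->] /M_portraitP[q qB ->].
apply/ffunP => i; rewrite -portrait_permM.
rewrite psi_portrait; last exact: balanced_mul.
by rewrite psi_exponentM // pm1_signM [RHS]ffunE !psi_portrait.
Qed.

Definition psi_morphism := Morphism psiM.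

(** * Surjectivity *)

Definition zeros : nat -> seq bool := nseq^~ false.

Definition fork y w : bool :=
  (w == y ++ false :: zeros k) (+) (w == y ++ true :: zeros k).

Lemma forkE y w b :
  fork y w = (w == y ++ b :: zeros k) (+) (w == y ++ ~~ b :: zeros k).
Proof. by case: b; rewrite // addbC. Qed.

Lemma fork_cat y w b t : size t = k ->
  fork y (w ++ b :: t) = (w == y) && (t == zeros k).
Proof.
move=> tk; rewrite /fork !eqseq_cat_cons ?size_nseq ?tk //.
by case: (w == y); case: b => /=; rewrite ?addbF.
Qed.

Lemma balanced_fork y : balanced (fork y).
Proof. by apply: balancedI => w t tk; rewrite !fork_cat. Qed.

Lemma parity_above_fork y w b : parity_above k (fork y) (rcons w b) = (w == y).
Proof.
rewrite -[RHS](parity_pred1 (fun=> w == y) (size_nseq k false)).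
by apply: eq_parity => t tk; rewrite cat_rcons fork_cat // [t == _]eq_sym.
Qed.

Definition standard_portrait w : bool :=
  if size w <= k then w == zeros (size w)
  else fork (zeros (size w - k.+1)) w.

Lemma balanced_standard : balanced standard_portrait.
Proof.
apply: balancedI => w t tk; rewrite /standard_portrait !size_cat /= tk.
by rewrite addnS ltnNge leq_addl /= !fork_cat.
Qed.

Lemma psi_exponent_standard i : psi_exponent standard_portrait i.
Proof.
rewrite /psi_exponent; case: leqP => ki.
  apply: etrans (parity_pred1 xpredT (size_nseq i false)).
  by apply: eq_parity => v vi; rewrite /standard_portrait vi ki eq_sym.
apply: etrans (parity_pred1 xpredT (size_nseq (i - k.+1) false)).
apply: eq_parity => v vi; rewrite eq_sym -(parity_above_fork _ v false).
apply: eq_parity => t tk; rewrite /standard_portrait size_cat size_rcons.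
by rewrite vi tk addSnnS subnK // leqNgt ki.
Qed.

Lemma psi_morphism_onto :
  (psi_morphism @* M L k.+2 n)%g = [set: {dffun forall i : 'I_n, pm1}].
Proof.
apply/setP => e; rewrite inE.
pose c i := if insub i is Some i' then e i' == pm1_sign true else false.
have cB : balanced (on_levels c standard_portrait).
  exact/balanced_on_levels/balanced_standard.
have cM : portrait_perm L n (on_levels c standard_portrait) \in M L k.+2 n.
  by apply/M_portraitP; exists (on_levels c standard_portrait).
suff <- : psi L k.+2 (portrait_perm L n (on_levels c standard_portrait)) = e.
  exact: (mem_morphim psi_morphism).
apply/ffunP => i; rewrite psi_portrait // psi_exponent_on_levels.
rewrite psi_exponent_standard andbT /c valK; have [b ->] := pm1_signP (e i).
by rewrite (inj_eq pm1_sign_inj) eqb_id.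
Qed.

(** * The kernel *)

Local Notation G := (M L k.+2 n).

Definition level_equiv j p q : Prop :=
  level_perm L n j (fun w => p w (+) q w) \in [~: G, G]%g.

Lemma eq_level_equiv j p q :
  (forall w, size w = j -> p w = q w) -> level_equiv j p q.
Proof.
move=> pq; rewrite /level_equiv (@eq_level_perm _ _ _ _ xpred0).
  by rewrite level_perm_pred0 group1.
by move=> w wj; rewrite pq ?addbb.
Qed.

Lemma level_equiv_trans j q p r :
  level_equiv j p q -> level_equiv j q r -> level_equiv j p r.
Proof.
rewrite /level_equiv => pq qr; have := groupM pq qr; rewrite -level_permD.
by under eq_level_perm do rewrite addbA addbK.
Qed.

Lemma level_equivD j p q p' q' :
    level_equiv j p q -> level_equiv j p' q' ->
  level_equiv j (fun w => p w (+) p' w) (fun w => q w (+) q' w).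
Proof.
rewrite /level_equiv => pq pq'; have := groupM pq pq'; rewrite -level_permD.
by under eq_level_perm do rewrite addbACA.
Qed.

Lemma level_equiv_parity j m (f h : seq bool -> pred (seq bool)) :
    (forall x, size x = m -> level_equiv j (f x) (h x)) ->
  level_equiv j (fun w => parity m (fun x => f x w))
                (fun w => parity m (fun x => h x w)).
Proof.
move=> fh; rewrite /level_equiv; under eq_level_perm do rewrite -parityD.
rewrite level_perm_parity; apply: group_prod => x _.
exact/fh/size_tuple.
Qed.

Lemma level_equiv_collapse j m (a : pred (seq bool))
    (f : seq bool -> pred (seq bool)) q :
    (forall x, size x = m -> level_equiv j (f x) q) ->
  level_equiv j (fun w => parity m (fun x => a x && f x w))
                (fun w => parity m a && q w).
Proof.
move=> fq.
apply: (level_equiv_trans (q := fun w => parity m (fun x => a x && q w))).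
  apply: level_equiv_parity => x xm; case: (a x); first exact: fq.
  exact: eq_level_equiv.
apply: eq_level_equiv => w _; under eq_parity do rewrite andbC.
by rewrite parityZ andbC.
Qed.

Lemma level_equiv_act j p q g : balanced p -> balanced g ->
  (forall w, q w = p (act g w)) -> level_equiv j q p.
Proof.
move=> pB gB qE; rewrite /level_equiv; under eq_level_perm do rewrite addbC qE.
rewrite level_permD -(level_permJ L n j p g) -{1}level_permV -commgEl.
rewrite mem_commg ?groupV //.
  apply/M_portraitP; exists (on_levels (pred1 j) p) => //.
  exact: balanced_on_levels.
apply/M_portraitP; exists (on_levels (gtn j) g) => //.
exact: balanced_on_levels.
Qed.

Definition translation x w : bool := nth false x (size w).

Lemma balanced_translation x : balanced (translation x).
Proof. by apply: balancedI => w t _; rewrite /translation !size_cat. Qed.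

Lemma act_translation x t : act (translation x) (x ++ t) = zeros (size x) ++ t.
Proof.
rewrite act_cat; congr cat; last first.
  apply: act_fix => v _.
  by rewrite /translation nth_default // size_cat leq_addr.
apply: (@eq_from_nth _ false); rewrite size_act ?size_nseq // => i ix.
by rewrite nth_act // /translation size_take ix addbb nth_nseq if_same.
Qed.

Lemma act_translation_id x : act (translation x) x = zeros (size x).
Proof. by have := act_translation x [::]; rewrite !cats0. Qed.

(* Translates, by [s], the bits following the one at position [r], but only
   where the latter is equal to [b]; the default value of [nth] excludes the
   words that are too short to have a bit there. *)
Definition half_translation r b s w : bool :=
  (nth (~~ b) w r == b) && translation s (drop r.+1 w).

Lemma balanced_half_translation r b s : size s = k ->
  balanced (half_translation r b s).
Proof.
move=> sk; apply: balancedI => w t tk; rewrite /half_translation /translation.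
rewrite !size_drop !size_cat /= tk !nth_cat.
case: (ltngtP r (size w)) => // [wr | ->].
  by rewrite -(prednK (n := r - size w)) // subn_gt0.
by rewrite (nth_default _ (s := s)) ?andbF // sk addnS subSS addKn.
Qed.

Lemma act_half_translation r b s y c t : size y = r ->
  act (half_translation r b s) (y ++ c :: t) =
  y ++ c :: (if c == b then act (translation s) t else t).
Proof.
move=> yr; have short v : size v <= r -> half_translation r b s v = false.
  by move=> vr; rewrite /half_translation nth_default //; case: b.
have long v :
    half_translation r b s (y ++ c :: v) = (c == b) && translation s v.
  rewrite /half_translation nth_cat yr ltnn subnn /= drop_cat yr.
  by rewrite ltnNge leqnSn /= subSnn /= drop0.
rewrite act_cat act_fix => [|v]; last by rewrite yr => /ltnW/short.
rewrite /= cats0 short ?yr // addbF; congr (_ ++ _ :: _).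
by have [cb|cb] := eqVneq c b; [apply: eq_act => v _ | apply: act_fix => v _];
  rewrite long ?cb ?eqxx // (negPf cb).
Qed.

Lemma balanced_pred1 x : size x <= k -> balanced (pred1 x).
Proof.
move=> xk w; apply: parity0 => v vk; apply: contraTF xk => /eqP <-.
by rewrite -ltnNge size_cat vk ltn_addl.
Qed.

Lemma level_equiv_pred1 j x : size x <= k ->
  level_equiv j (pred1 x) (pred1 (zeros (size x))).
Proof.
move=> xk; have zk : size (zeros (size x)) <= k by rewrite size_nseq.
apply: level_equiv_act (balanced_pred1 zk) (balanced_translation x) _ => w.
by rewrite /= -act_translation_id eq_act_eq.
Qed.

Lemma level_equiv_fork j y : level_equiv j (fork y) (fork (zeros (size y))).
Proof.
apply: level_equiv_act (balanced_fork _) (balanced_translation y) _ => w.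
by rewrite /fork -!act_translation !eq_act_eq.
Qed.

Lemma level_equiv_fork_half j y b s : size s = k ->
  level_equiv j (pred1 (y ++ b :: s)) (pred1 (y ++ b :: zeros k)).
Proof.
move=> sk; pose g := half_translation (size y) b s.
have moved : act g (y ++ b :: s) = y ++ b :: zeros k.
  by rewrite act_half_translation // eqxx act_translation_id sk.
have fixed : act g (y ++ ~~ b :: zeros k) = y ++ ~~ b :: zeros k.
  by rewrite act_half_translation //; case: (b).
pose q w := (w == y ++ b :: s) (+) (w == y ++ ~~ b :: zeros k).
have : level_equiv j q (fork y).
  have gB := balanced_half_translation (size y) b sk.
  apply: level_equiv_act (balanced_fork y) gB _ => w.
  by rewrite -/g (forkE y _ b) -moved -fixed !eq_act_eq.
rewrite /level_equiv.
by under eq_level_perm do rewrite (forkE y _ b) addbACA addbb addbF.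
Qed.

(* One level above [y], the parities over the two halves agree, which turns the
   two collapsed halves into a fork. *)
Lemma level_equiv_cone j p y : balanced p ->
  level_equiv j (fun w => parity k.+1 (fun t => p (y ++ t) && (w == y ++ t)))
                (fun w => parity_above k p (rcons y false) && fork y w).
Proof.
move=> pB.
have half b : level_equiv j
    (fun w => parity k (fun t => p (y ++ b :: t) && (w == y ++ b :: t)))
    (fun w => parity_above k p (rcons y b) && (w == y ++ b :: zeros k)).
  rewrite /parity_above; under eq_parity do rewrite cat_rcons.
  exact: level_equiv_collapse (fun s => @level_equiv_fork_half j y b s).
have halves := level_equivD (half false) (half true).
apply: level_equiv_trans (level_equiv_trans halves _).
  by apply: eq_level_equiv => w _; rewrite parity_cons.
by apply: eq_level_equiv => w _; rewrite (balanced_rcons _ true pB) andb_addr.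
Qed.

Lemma level_equiv_standard j p : balanced p ->
  level_equiv j p (fun w => psi_exponent p j && standard_portrait w).
Proof.
move=> pB; rewrite /psi_exponent; have [jk|kj] := leqP j k.
  apply: (level_equiv_trans
    (q := fun w => parity j (fun x => p x && (w == x)))).
    by apply: eq_level_equiv => w wj; rewrite parity_pred1.
  apply: (level_equiv_trans (q := fun w => parity j p && (w == zeros j))).
    apply: level_equiv_collapse => x xj; rewrite -xj.
    by apply: level_equiv_pred1; rewrite xj.
  by apply: eq_level_equiv => w wj; rewrite /standard_portrait wj jk.
set r := j - k.+1; pose a y := parity_above k p (rcons y false).
apply: (level_equiv_trans (q := fun w => parity r (fun y =>
    parity k.+1 (fun t => p (y ++ t) && (w == y ++ t))))).
  apply: eq_level_equiv => w wj.
  rewrite -(parity_cat r k.+1 (fun x => p x && (w == x))) subnK //.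
  by rewrite parity_pred1.
apply: (level_equiv_trans (q := fun w => parity r (fun y => a y && fork y w))).
  by apply: level_equiv_parity => y _; apply: level_equiv_cone.
apply: (level_equiv_trans (q := fun w => parity r a && fork (zeros r) w)).
  by apply: level_equiv_collapse => y yr; rewrite -yr; apply: level_equiv_fork.
by apply: eq_level_equiv => w wj; rewrite /standard_portrait wj leqNgt kj.
Qed.

Lemma level_perm_der1 j p : balanced p -> psi_exponent p j = false ->
  level_perm L n j p \in [~: G, G]%g.
Proof.
move=> pB p0; have := level_equiv_standard j pB; rewrite /level_equiv p0.
by under eq_level_perm do rewrite addbF.
Qed.

Lemma portrait_perm_der1 p : balanced p ->
    (forall i, i < n -> psi_exponent p i = false) ->
  portrait_perm L n p \in [~: G, G]%g.
Proof.
move=> pB p0.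
have truncated m : m <= n ->
    portrait_perm L n (on_levels (gtn m) p) \in [~: G, G]%g.
  elim: m => [_|m IHm mn].
    by rewrite (@eq_portrait_perm _ _ _ xpred0) ?portrait_perm_pred0 ?group1.
  by rewrite portrait_perm_truncateS groupM ?IHm ?level_perm_der1 ?p0 // ltnW.
rewrite (@eq_portrait_perm _ _ _ (on_levels (gtn n) p)) ?truncated // => w wn.
by rewrite /on_levels /= wn.
Qed.

Lemma ker_psi_morphism : ('ker psi_morphism = [~: G, G])%g.
Proof.
apply/eqP; rewrite eqEsubset; apply/andP; split.
  apply/subsetP => s /morphpreP[/M_portraitP[p pB ->] /set1P/= p1].
  apply: portrait_perm_der1 => // i ni; apply: pm1_sign_inj.
  by rewrite -(psi_portrait (Ordinal ni) pB) p1 ffunE.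
have sGG : [~: G, G]%g \subset G := der1_subG _.
rewrite -(sub_morphim_pre _ _ sGG) morphimR // psi_morphism_onto.
apply/trivgP/commG1P/centsP => e _ e' _.
by apply/ffunP => i; rewrite !ffunE mulgC_pm1.
Qed.

End BalancedPortraits.

Theorem theorem5p5 (L : labeling) (l n : nat) (hl : 2 <= l) :
  (exists f : {morphism M L l n >-> {dffun forall i : 'I_n, pm1}},
     [/\ {in M L l n, f =1 psi L l (n := n)},
         (f @* M L l n = [set: {dffun forall i : 'I_n, pm1}])%g &
         ('ker f = [~: M L l n, M L l n])%g]) /\
  (M L l n / [~: M L l n, M L l n] \isog
     [set: {dffun forall i : 'I_n, pm1}])%g.
Proof.
case: l hl => [|[|k]] // _; have im := psi_morphism_onto L k n.
have ker := ker_psi_morphism L k n; split; first by exists (psi_morphism L k n).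
by rewrite -ker -im; apply: first_isog.
Qed.
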